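(* Let $A,B,C$ be an additive hypergeometric triple on $\mathbb{C}^m$, with eigenvalues $b_i$ of $B$ and $-c_i$ of $C$, normalized eigenvectors $v_i$, $w_i$, and operator $S$ as defined in the context. Let $k_1,k_2$ be arbitrary complex constants and let $B(\tau_1)$, $C(\tau_2)$ be the solutions (with complex times $\tau_1,\tau_2$) of $$\dot B(\tau_1)+[B(\tau_1),S]=k_1\,\mathrm{Id},\quad B(0)=B;\qquad \dot C(\tau_2)-[C(\tau_2),S]=k_2\,\mathrm{Id},\quad C(0)=C.$$ Then the eigenvalues of $B(\tau_1)$ and $C(\tau_2)$ evolve linearly: they are $b_i(\tau_1)=b_i+k_1\tau_1$ and $-c_i(\tau_2)=-c_i+k_2\tau_2$, $i=1,\dots,m$, and the corresponding eigenvectors are $$v_i(\tau_1)=e^{S\tau_1}v_i,\qquad w_i(\tau_2)=e^{-S\tau_2}w_i .$$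
   Context: Additive hypergeometric triple: linear operators $A,B,C$ on $\mathbb{C}^m$ such that $A+B+C=0$; $\operatorname{rank}B=\operatorname{rank}C=m$; $A$ is diagonalizable with two different eigenvalues, $a_1$ of multiplicity $1$ and $a_2$ of multiplicity $m-1$; and the operators are generic within these restrictions. The eigenvalues of $B$ are $b_1,\dots,b_m$ with eigenvectors $v_1,\dots,v_m$, and the eigenvalues of $C$ are $-c_1,\dots,-c_m$ with eigenvectors $w_1,\dots,w_m$. Genericity implies that the eigenvalues are generic complex numbers subject to the trace condition $a_1+(m-1)a_2+\sum_{i}(b_i-c_i)=0$ (in particular $b_i-b_j\notin\mathbb{Z}$ and $c_i-c_j\notin\mathbb{Z}$ for $i\ne j$, and $b_i-c_j\notin\mathbb{Z}$ for all $i,j$), and that, if $u$ is an eigenvector of $A$ for $a_1$, there is a unique scaling of the eigenvectors with $\sum_i v_i=\sum_i w_i=u$; this scaling is fixed. Let $V$ be the operator sending the $i$-th standard basis vector to $v_i$, let $X$ be the $m\times m$ matrix with $X_{ij}=\frac{1}{b_j-b_i}$ for $i\neq j$ and $X_{ii}=-\sum_{j\ne i}\frac{1}{b_j-b_i}$, and put $S=VXV^{-1}$. $[\cdot,\cdot]$ is the commutator, $\mathrm{Id}$ the identity. *)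

(* Defs.v *)
From HB Require Import structures.
From mathcomp Require Import all_boot all_order all_algebra.
From mathcomp Require Import complex.
From mathcomp Require Import all_classical all_reals all_analysis.

Set Implicit Arguments.
Unset Strict Implicit.
Unset Printing Implicit Defensive.

Import Order.TTheory GRing.Theory Num.Theory.
Import numFieldNormedType.Exports.

Local Open Scope classical_set_scope.
Local Open Scope ring_scope.

(** Complex numbers are [R[i]] for [R : realType].  Operators on C^m are square
    matrices acting on column vectors by [M *m x]. *)

Definition mxcommutator (K : comNzRingType) (m : nat) (M N : 'M[K]_m) : 'M[K]_m :=
  M *m N - N *m M.

Definition mxexp (K : numFieldType) (m : nat) (M : 'M[K]_m) : 'M[K]_m :=
  limn (series (fun n : nat => (n`!%:R)^-1 *: M ^+ n)).

Definition entire (K : numFieldType) (V : normedModType K) (f : K -> V) : Prop :=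
  forall t : K, derivable f t 1.

(** [lam] lists the eigenvalues of [M], with algebraic multiplicity, and [e i]
    is an eigenvector for [lam i].  Independence of the [e i] is not built in. *)
Definition eigensystem (K : fieldType) (m : nat) (M : 'M[K]_m)
    (lam : 'I_m -> K) (e : 'I_m -> 'cV[K]_m) : Prop :=
  char_poly M = \prod_(i < m) ('X - (lam i)%:P) /\
  (forall i, e i != 0 /\ M *m e i = lam i *: e i).

Definition not_integer (K : pzRingType) (z : K) : Prop :=
  forall n : int, z != n%:~R.

(** An additive hypergeometric triple together with its spectral data.
    "Generic" is rendered by the explicit conditions it is used for: the three
    non-resonance conditions, and the existence of eigenvectors normalized by
    [\sum_i v i = \sum_i w i = u].  The trace condition follows from
    [A + B + C = 0], and uniqueness of the normalization from
    the [b i], respectively the [c i], being pairwise distinct. *)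
Record hypergeometric_triple (R : realType) (m : nat) (A B C : 'M[R[i]]_m)
    (a1 a2 : R[i]) (b c : 'I_m -> R[i])
    (u : 'cV[R[i]]_m) (v w : 'I_m -> 'cV[R[i]]_m) : Prop := {
  ht_sum0 : A + B + C = 0;
  ht_rankB : \rank B = m;
  ht_rankC : \rank C = m;
  ht_dim : (1 < m)%N;
  ht_a_neq : a1 != a2;
  ht_diagA : diagonalizable A;
  ht_charA : char_poly A = ('X - a1%:P) * ('X - a2%:P) ^+ m.-1;
  ht_eigB : eigensystem B b v;
  ht_eigC : eigensystem C (fun i => - c i) w;
  ht_genb : forall i j, i != j -> not_integer (b i - b j);
  ht_genc : forall i j, i != j -> not_integer (c i - c j);
  ht_genbc : forall i j, not_integer (b i - c j);
  ht_u_neq0 : u != 0;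
  ht_eigA : A *m u = a1 *: u;
  ht_sumv : \sum_(i < m) v i = u;
  ht_sumw : \sum_(i < m) w i = u
}.

Definition Xmx (K : fieldType) (m : nat) (b : 'I_m -> K) : 'M[K]_m :=
  \matrix_(i, j)
    if i == j then - \sum_(k < m | k != i) (b k - b i)^-1
    else (b j - b i)^-1.

Definition Vmx (K : fieldType) (m : nat) (v : 'I_m -> 'cV[K]_m) : 'M[K]_m :=
  \matrix_(r, i) v i r 0.

Definition Smx (K : fieldType) (m : nat) (b : 'I_m -> K)
    (v : 'I_m -> 'cV[K]_m) : 'M[K]_m :=
  Vmx v *m Xmx b *m invmx (Vmx v).

(* Main.v *)
Require Import Defs.
From HB Require Import structures.
From mathcomp Require Import all_boot all_order all_algebra.
From mathcomp Require Import complex.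
From mathcomp Require Import all_classical all_reals all_analysis.
From mathcomp Require Import ring.

(** The flow is a conjugation: [exp(-tS) (B(t) - k1 t) exp(tS)] has zero
    derivative, hence [B(t) = exp(tS) B exp(-tS) + k1 t], whose eigenvectors are
    [exp(tS) v_i].  The equation for [C] is the one for [B] with [S] replaced by
    [-S].  Each entry of [exp(tS)] is a power series [\sum_n t^n a_n / n!] with
    [a_n] of geometric growth; a Taylor remainder quadratic in the increment
    shows that its derivative is obtained by shifting [a].  A complex function
    with zero derivative is constant because its real and imaginary parts
    are, along each real line through the origin. *)

Set Implicit Arguments.
Unset Strict Implicit.
Unset Printing Implicit Defensive.

Import Order.TTheory GRing.Theory Num.Theory.
Import numFieldNormedType.Exports.

Local Open Scope classical_set_scope.
Local Open Scope ring_scope.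

(** * Limits and derivatives of matrices, entry by entry *)

Lemma cvg_mx (K : numFieldType) m n (T : Type) (F : set_system T)
    {FF : Filter F} (f : T -> 'M[K]_(m, n)) (l : 'M[K]_(m, n)) :
  (forall i j, f x i j @[x --> F] --> l i j) -> f x @[x --> F] --> l.
Proof.
move=> fl; apply/cvg_ballP => e e0.
have : \forall x \near F, forall ij : 'I_m * 'I_n,
    ball (l ij.1 ij.2) e (f x ij.1 ij.2).
  by apply: filter_forall => -[i j] /=; exact: (cvg_ball (fl i j)).
by apply: filterS => x fx; split=> // i j; exact: (fx (i, j)).
Qed.

Lemma derivable_mx_coord (K : numFieldType) m n (M : K -> 'M[K]_(m, n)) t i j :
  derivable M t 1 -> is_derive t 1 (fun x => M x i j) (derive1 M t i j).
Proof.
move=> Mt.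
have Mc : h^-1 *: (M (h *: 1 + t) - M t) @[h --> 0^'] --> derive1 M t.
  by rewrite derive1E; exact: Mt.
have H := cvg_comp _ _ Mc (@coord_continuous K m n i j _).
have {}H : h^-1 *: (M (h *: 1 + t) i j - M t i j) @[h --> 0^'] -->
    derive1 M t i j.
  by apply: cvg_trans H; apply: near_eq_cvg; near=> h; rewrite /= !mxE.
by apply: DeriveDef; [exact: cvgP H | exact: cvg_lim H].
Unshelve. all: by end_near. Qed.

(** * Derivatives from quadratic remainder bounds *)

Lemma is_derive_quad (K : numFieldType) (f : K -> K) (s d M : K) :
  0 <= M ->
  (forall h, `|h| <= 1 -> `|f (h + s) - f s - h * d| <= M * `|h| ^+ 2) ->
  is_derive s 1 f d.
Proof.
move=> M0 fM.
have H : h^-1 *: (f (h *: (1 : K) + s) - f s) @[h --> 0^'] --> d.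
  apply/cvgrPdist_le => e e0; near=> h.
  have h0 : h != 0 by near: h; exact: nbhs_dnbhs_neq.
  have h1 : `|h| <= 1 by near: h; exact: dnbhs0_le.
  (* The quotient is off from [d] by at most M|h|; dividing by [M + 1] rather than [M] covers
     [M = 0]. *)
  have he : `|h| <= e / (M + 1).
    by near: h; apply: dnbhs0_le; rewrite divr_gt0// ltr_wpDl.
  rewrite -normrN opprB.
  rewrite [X in `|X|](_ : _ = h^-1 * (f (h + s) - f s - h * d)); last first.
    by rewrite /GRing.scale /= mulr1 [in RHS]mulrBr mulKf.
  rewrite normrM normfV ler_pdivrMl ?normr_gt0//.
  apply: (le_trans (fM _ h1)); rewrite expr2 mulrCA ler_wpM2l//.
  have M1 : 0 < M + 1 by rewrite ltr_wpDl.
  have := ler_wpM2l (ltW M1) he; rewrite mulrCA divff ?gt_eqF// mulr1.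
  by apply: le_trans; rewrite ler_wpM2r// lerDl.
by apply: DeriveDef; [exact: cvgP H | exact: cvg_lim H].
Unshelve. all: by end_near. Qed.

Lemma lim_norm_le (K : numFieldType) (u : nat -> K) (l M : K) :
  u @ \oo --> l -> (forall n, `|u n| <= M) -> `|l| <= M.
Proof.
move=> ul uM.
have M0 : 0 <= M by exact: le_trans (normr_ge0 _) (uM 0%N).
(* The order of [K] is only partial; negating the inequality is legitimate because both sides are
   nonnegative, hence real. *)
rewrite real_leNgt ?ger0_real//; apply/negP => Ml.
have e0 : 0 < `|l| - M by rewrite subr_gt0.
move/cvgrPdist_lt : ul => /(_ _ e0) /filter_ex[n /=].
rewrite ltrBrDr => /lt_le_trans /(_ (lexx _)).
suff : `|l| <= `|l - u n| + M by move=> /le_lt_trans /[apply]; rewrite ltxx.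
by rewrite -[X in `|X| <= _](subrK (u n)) (le_trans (ler_normD _ _))// lerD2l.
Qed.

(** Induction on [n]: the remainders satisfy R(n+1) = (h + s) R(n) + n s^(n-1) h^2. The bound splits
    accordingly as (2 rho)^(n+1) = rho (2 rho)^n + 2^n rho^(n+1), where n <= 2^n and [1 <= rho]
    absorb the second term. *)
Lemma norm_exp_taylor1 (K : numFieldType) (s h rho : K) n :
  `|s| <= rho -> `|h + s| <= rho -> 1 <= rho ->
  `|(h + s) ^+ n - s ^+ n - h * (n%:R * s ^+ n.-1)| <=
    (2 * rho) ^+ n * `|h| ^+ 2.
Proof.
move=> srho hrho rho1; have rho0 : 0 <= rho by exact: le_trans rho1.
elim: n => [|n IH].
  by rewrite !expr0 subrr mul0r mulr0 subrr normr0 mul1r exprn_ge0.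
have -> : (h + s) ^+ n.+1 - s ^+ n.+1 - h * (n.+1%:R * s ^+ n) =
    (h + s) * ((h + s) ^+ n - s ^+ n - h * (n%:R * s ^+ n.-1)) +
    n%:R * s ^+ n.-1 * h ^+ 2.
  (* Since [n.-1] is truncated, s * s^(n.-1) = s^n fails at [n = 0], which is therefore treated
     apart. *)
  case: n {IH} => [|n] /=; first by rewrite !expr0; ring.
  by rewrite !exprS -natr1; ring.
have -> : (2 * rho) ^+ n.+1 * `|h| ^+ 2 = rho * ((2 * rho) ^+ n * `|h| ^+ 2) +
    (2 ^+ n * rho ^+ n.+1) * `|h| ^+ 2.
  by rewrite !(exprSr _ n) exprMn; ring.
rewrite (le_trans (ler_normD _ _))// lerD//.
  by rewrite normrM ler_pM// ?normr_ge0//.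
rewrite normrM normrX ler_wpM2r ?exprn_ge0// normrM normr_nat.
rewrite ler_pM ?normr_ge0// ?ler0n//.
  by rewrite -natrX ler_nat ltnW// ltn_expl.
rewrite normrX; apply: (@le_trans _ _ (rho ^+ n.-1)); first exact: lerXn2r.
by rewrite ler_weXn2l// (leq_trans (leq_pred _)).
Qed.

(** * Real and imaginary parts; convergence of complex series *)

Lemma ReImD (R : rcfType) (x y : R[i]) :
  complex.Re (x + y) = complex.Re x + complex.Re y /\
  complex.Im (x + y) = complex.Im x + complex.Im y.
Proof. by case: x; case: y. Qed.

Lemma ReImB (R : rcfType) (x y : R[i]) :
  complex.Re (x - y) = complex.Re x - complex.Re y /\
  complex.Im (x - y) = complex.Im x - complex.Im y.
Proof. by case: x; case: y. Qed.

Lemma norm_le_ReIm (R : rcfType) (z : R[i]) :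
  `|z| <= (`|complex.Re z| + `|complex.Im z|)%:C%C.
Proof.
rewrite [X in `|X| <= _]complexE (le_trans (ler_normD _ _))// rmorphD /= lerD//.
  by rewrite normc_def /= expr0n /= addr0 sqrtr_sqr.
rewrite normrM !normc_def /= !expr0n /= expr1n add0r addr0 sqrtr1 mul1r.
by rewrite sqrtr_sqr.
Qed.

(** Multiplication by i preserves the norm and turns the imaginary part, up to sign, into the real
    part. *)
Lemma normc_ge_Im (R : rcfType) (z : R[i]) : `|complex.Im z|%:C%C <= `|z|.
Proof.
have := normc_ge_Re (z * 'i%C).
rewrite ReiNIm normrN normrM (normc_def 'i%C) /=.
by rewrite expr0n expr1n add0r sqrtr1 mulr1.
Qed.

Lemma Re_norm (R : rcfType) (z : R[i]) : (complex.Re `|z|)%:C%C = `|z|.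
Proof. by rewrite normc_def. Qed.

Lemma normr_complexR (R : rcfType) (x : R) : `|x%:C%C| = `|x|%:C%C.
Proof. by rewrite normc_def /= expr0n addr0 sqrtr_sqr. Qed.

Lemma cvg_complex (R : realType) (T : Type) (F : set_system T) {FF : Filter F}
    (f : T -> (R[i] : numFieldType)) (l : (R[i] : numFieldType)) :
  complex.Re (f x) @[x --> F] --> complex.Re l ->
  complex.Im (f x) @[x --> F] --> complex.Im l ->
  f x @[x --> F] --> l.
Proof.
move=> fRe fIm; apply/cvgrPdist_le => e e0.
(* The radius [e] is a complex number; being positive, it is real. *)
have eE : (complex.Re e)%:C%C = e by rewrite RRe_real// gtr0_real.
have e2 : 0 < complex.Re e / 2 by rewrite divr_gt0// -ltcR eE.
near=> x; rewrite (le_trans (norm_le_ReIm _))// -eE lecR [leRHS]splitr lerD//.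
- rewrite (ReImB _ _).1; near: x.
  by move/cvgrPdist_le : fRe; apply.
- rewrite (ReImB _ _).2; near: x.
  by move/cvgrPdist_le : fIm; apply.
Unshelve. all: by end_near. Qed.

(** Both parts of the terms are dominated by [g], so their series converge absolutely; completeness
    is invoked only in [R]. *)
Lemma is_cvg_series_dominated (R : realType)
    (a : nat -> (R[i] : numFieldType)) (g : nat -> R) :
  (forall n, `|a n| <= (g n)%:C%C) -> cvgn (series g) -> cvgn (series a).
Proof.
move=> ag gcvg.
(* [p] stands for [complex.Re] and [complex.Im] at once. *)
have pcvg (p : R[i] -> R) : (forall z, `|p z|%:C%C <= `|z|) ->
    cvgn (series (fun k => p (a k))).
  move=> pz; apply: normed_cvg; apply: series_le_cvg gcvg => n //=.
    by rewrite -lecR (le_trans _ (ag n))// normr_ge0.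
  by rewrite -lecR (le_trans (pz _)).
have ReC := pcvg (@complex.Re R) (@normc_ge_Re R).
have ImC := pcvg (@complex.Im R) (@normc_ge_Im R).
apply/cvg_ex; exists (limn (series (fun k => complex.Re (a k))) +i*
  limn (series (fun k => complex.Im (a k))))%C.
apply: cvg_complex => /=.
- apply: cvg_trans ReC; apply: near_eq_cvg; near=> n; rewrite /series /=.
  by rewrite (big_morph _ (fun x y => (ReImD x y).1) (erefl (complex.Re 0))).
- apply: cvg_trans ImC; apply: near_eq_cvg; near=> n; rewrite /series /=.
  by rewrite (big_morph _ (fun x y => (ReImD x y).2) (erefl (complex.Im 0))).
Unshelve. all: by end_near. Qed.

(** * Exponential generating functions and their derivatives *)

Section exponential_generating_function.
Context (R : realType).
Local Notation C := (R[i] : numFieldType).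
Implicit Types (a : nat -> C) (s : C) (r x M : R).

Definition egf_term a s : nat -> C := fun n => n`!%:R^-1 * s ^+ n * a n.

Definition egf a s : C := limn (series (egf_term a s)).

Lemma series_exp_coeff_le x n : 0 <= x -> series (exp_coeff x) n <= expR x.
Proof.
move=> x0; apply: nondecreasing_cvgn_le; last exact: is_cvg_series_exp_coeff.
by apply: nondecreasing_series => k _ _; exact: exp_coeff_ge0.
Qed.

Lemma exp_coeffC x n : (exp_coeff x n)%:C%C = n`!%:R^-1 * x%:C%C ^+ n :> C.
Proof. by rewrite /exp_coeff /= rmorphM fmorphV rmorph_nat rmorphXn mulrC. Qed.

Lemma cvg_egf a s M r : (forall n, `|a n| <= M%:C%C * r%:C%C ^+ n) ->
  series (egf_term a s) @ \oo --> egf a s.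
Proof.
move=> ar.
(* The majorant is the exponential series of |s| r, multiplied by [M]. *)
apply: (is_cvg_series_dominated (g := M \o* exp_coeff (complex.Re `|s| * r))).
  move=> n; have -> : ((M \o* exp_coeff (complex.Re `|s| * r)) n)%:C%C =
      (exp_coeff (complex.Re `|s| * r) n)%:C%C * M%:C%C :> C by exact: rmorphM.
  rewrite exp_coeffC rmorphM /= Re_norm /egf_term.
  rewrite normrM normrM normfV normr_nat normrX exprMn.
  rewrite [leRHS](_ : _ = n`!%:R^-1 * `|s| ^+ n * (M%:C%C * r%:C%C ^+ n));
    last by ring.
  by rewrite ler_wpM2l// ?mulr_ge0 ?invr_ge0 ?ler0n ?exprn_ge0 ?normr_ge0.
rewrite (_ : series _ = M \*o series (exp_coeff (complex.Re `|s| * r))).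
  by apply: is_cvgM; [exact: is_cvg_cst | exact: is_cvg_series_exp_coeff].
by apply/funext => n; rewrite /series /= -mulr_suml mulrC.
Qed.

(** The quadratic bound is proved for partial sums, term by term and uniformly in their length, and
    then passed to the limit. *)
Lemma is_derive_egf a s M r : (forall n, `|a n| <= M%:C%C * r%:C%C ^+ n) ->
  0 <= r -> is_derive s 1 (egf a) (egf (fun n => a n.+1) s).
Proof.
move=> ar r0.
have M0 : 0 <= M.
  by rewrite -ler0c; have := ar 0%N; rewrite mulr1; apply: le_trans.
(* [rho] is at least 1 and bounds both |s| and |h + s| whenever |h| <= 1. *)
pose rho := complex.Re `|s| + 1.
have rho0 : 0 <= rho by rewrite addr_ge0// -ler0c Re_norm normr_ge0.
have rho2E : (2 * rho)%:C%C = 2 * (`|s| + 1) :> C.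
  by rewrite rmorphM rmorph_nat /= rmorphD /= Re_norm rmorph1.
have ar' n : `|a n.+1| <= (M * r)%:C%C * r%:C%C ^+ n.
  by rewrite (le_trans (ar _))// rmorphM exprS mulrA.
(* The constant is the sum over k of (2 rho)^k / k! times M r^k. *)
apply: (is_derive_quad (M := (M * expR (2 * rho * r))%:C%C)).
  by rewrite ler0c mulr_ge0// expR_ge0.
move=> h h1.
(* The derived series is cut one term earlier: its k-th term pairs with the term of index k + 1 in
   the other two. *)
pose q n := series (egf_term a (h + s)) n.+1 - series (egf_term a s) n.+1 -
  h * series (egf_term (fun n => a n.+1) s) n.
have qcvg : q @ \oo --> egf a (h + s) - egf a s - h * egf (fun n => a n.+1) s.
  apply: cvgB; first apply: cvgB.
  - have := cvg_egf (s := h + s) ar; rewrite -cvg_shiftS; exact.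
  - have := cvg_egf (s := s) ar; rewrite -cvg_shiftS; exact.
  - exact: cvgM (cvg_cst h) (cvg_egf ar').
apply: (lim_norm_le qcvg) => n.
have -> : q n = \sum_(0 <= k < n.+1) k`!%:R^-1 *
    ((h + s) ^+ k - s ^+ k - h * (k%:R * s ^+ k.-1)) * a k.
  rewrite /q /series /= mulr_sumr.
  (* Reindexing by one: the new term [k = 0] vanishes through its factor [k%:R], and (k+1)/(k+1)! =
     1/k!. *)
  rewrite [X in _ - X](_ : _ = \sum_(0 <= k < n.+1)
      k`!%:R^-1 * (h * (k%:R * s ^+ k.-1)) * a k); last first.
    rewrite [RHS]big_nat_recl// mul0r !mulr0 mul0r add0r; apply: eq_bigr => k _.
    rewrite /egf_term factS natrM invfM /=.
    have : k.+1%:R != 0 :> C by rewrite pnatr_eq0.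
    by move: (k`!%:R^-1) (k.+1%:R) => f k1 k0; field.
  by rewrite -!sumrB; apply: eq_bigr => k _; rewrite /egf_term; ring.
apply: (@le_trans _ _ (\sum_(0 <= k < n.+1)
    (exp_coeff (2 * rho * r) k)%:C%C * (M%:C%C * `|h| ^+ 2))).
  rewrite (le_trans (ler_norm_sum _ _ _))// ler_sum// => k _.
  rewrite exp_coeffC !normrM normfV normr_nat [_%:C%C in leRHS]rmorphM exprMn.
  rewrite [leRHS](_ : _ = k`!%:R^-1 * ((2 * rho)%:C%C ^+ k * `|h| ^+ 2) *
    (M%:C%C * r%:C%C ^+ k)); last by ring.
  rewrite ler_pM ?mulr_ge0 ?normr_ge0 ?invr_ge0 ?ler0n//.
  rewrite ler_wpM2l ?invr_ge0 ?ler0n//.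
  rewrite rho2E; apply: norm_exp_taylor1.
  - by rewrite lerDl.
  - by rewrite addrC (le_trans (ler_normD _ _))// lerD2l.
  - by rewrite lerDr normr_ge0.
rewrite -mulr_suml mulrA ler_wpM2r ?exprn_ge0 ?normr_ge0//.
rewrite -rmorph_sum -rmorphM lecR mulrC ler_wpM2l//; apply: series_exp_coeff_le.
by rewrite !mulr_ge0.
Qed.

End exponential_generating_function.

(** * Complex functions with zero derivative *)

(** Clearing the denominator admits the increment [k = 0], which occurs below for increments h s
    with [s = 0]. *)
Lemma is_derive0_dist (K : numFieldType) (f : K -> K) (t e : K) :
  is_derive t 1 f 0 -> 0 < e ->
  exists2 d, 0 < d & forall k, `|k| < d -> `|f (k + t) - f t| <= e * `|k|.
Proof.
move=> ft e0.
have ft' : h^-1 *: (f (h *: (1 : K) + t) - f t) @[h --> 0^'] --> (0 : K).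
  by rewrite -[X in _ --> X](@derive_val _ _ _ _ _ _ _ ft); exact: ex_derive.
move/cvgrPdist_le : ft' => /(_ _ e0)[d /= d0 df]; exists d => // k kd.
have [->|k0] := eqVneq k 0; first by rewrite add0r subrr normr0 mulr0.
have := df k _ k0; rewrite /ball_/= !sub0r !normrN => /(_ kd).
by rewrite /GRing.scale/= mulr1 normrM normfV ler_pdivrMl ?normr_gt0// mulrC.
Qed.

Lemma is_derive0_cst (R : realType) (K := R[i] : numFieldType)
    (f : K -> K) (s : K) :
  (forall t : K, is_derive t 1 f 0) -> f s = f 0.
Proof.
move=> f0.
have ns0 : 0 < complex.Re `|s| + 1.
  by rewrite ltr_wpDl// -ler0c Re_norm normr_ge0.
(* With [p] the real or imaginary part, x |-> p (f (x s)) is a real function of a real variable; its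
   values at 1 and 0 are compared. *)
have cst (p : R[i] -> R) : {morph p : x y / x - y} ->
    (forall z, `|p z|%:C%C <= `|z|) -> p (f s) = p (f 0).
  move=> pB pz.
  suff px (x : R) : is_derive x 1 (fun x : R => p (f (x%:C%C * s))) 0.
    by have := is_derive_0_is_cst 1 0 px; rewrite mul1r mul0r.
  have H : h^-1 *: (p (f ((h *: 1 + x)%:C%C * s)) - p (f (x%:C%C * s)))
      @[h --> 0^'] --> (0 : R).
    apply/cvgrPdist_le => e e0.
    (* A real increment h moves the argument by h s, so the tolerance is divided by |s| + 1, which
       is positive even for [s = 0]. *)
    have e1 : 0 < (e / (complex.Re `|s| + 1))%:C%C :> K.
      by rewrite ltcR divr_gt0.
    have [d d0 df] := is_derive0_dist (f0 (x%:C%C * s)) e1.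
    have dE : (complex.Re d)%:C%C = d by rewrite RRe_real// gtr0_real.
    have d0' : 0 < complex.Re d by rewrite -ltcR dE.
    near=> h; have h0 : h != 0 by near: h; exact: nbhs_dnbhs_neq.
    have hd : `|h| < complex.Re d / (complex.Re `|s| + 1).
      by near: h; apply: dnbhs0_lt; rewrite divr_gt0.
    rewrite sub0r normrN /GRing.scale /= mulr1 normrM normfV.
    rewrite ler_pdivrMl ?normr_gt0//.
    have hs : `|h%:C%C * s| = (`|h| * complex.Re `|s|)%:C%C :> K.
      by rewrite normrM normr_complexR -[in LHS]Re_norm -rmorphM.
    have := df (h%:C%C * s); rewrite hs -[d in _ < d]dE ltcR.
    rewrite -mulrDl -rmorphD /= => /(_ _).
    have -> : `|h| * complex.Re `|s| < complex.Re d.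
      move: hd; rewrite ltr_pdivlMr//; apply: le_lt_trans.
      by rewrite ler_wpM2l// lerDl.
    move=> /(_ isT) dfh; rewrite -lecR -pB (le_trans (pz _))// (le_trans dfh)//.
    rewrite -rmorphM lecR mulrC -mulrA ler_wpM2l// mulrCA ger_pMr//.
    by rewrite ler_pdivrMr// mul1r lerDl.
  by apply: DeriveDef; [exact: cvgP H | exact: cvg_lim H].
apply/eqP; rewrite eq_complex; apply/andP; split; apply/eqP; apply: cst.
- by move=> x y; exact: (ReImB x y).1.
- exact: normc_ge_Re.
- by move=> x y; exact: (ReImB x y).2.
- exact: normc_ge_Im.
Unshelve. all: by end_near. Qed.

(** * Conjugation and scalar shifts of matrices *)

(** With E = exp(-tS), F = exp(tS) and c = kt, the left side is the product-rule derivative of E (B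
    - c) F when B' = k - [B,S]. It cancels because the scalar [c] commutes with [S]. *)
Lemma lax_cancel (K : comNzRingType) m (E F B S : 'M[K]_m) (c k : K) :
  (E *m - S *m (B - c%:M) + E *m (k%:M - mxcommutator B S - k%:M)) *m F +
    E *m (B - c%:M) *m (S *m F) = 0.
Proof.
(* [H] is made opaque so that distributivity does not expand it. *)
have [H HE] : exists H, H = B - c%:M by exists (B - c%:M).
have -> : k%:M - mxcommutator B S - k%:M = S *m H - H *m S.
  rewrite HE mulmxBr mulmxBl scalar_mxC addrAC subrr add0r opprB.
  by rewrite (opprB (B *m S)) addrA subrK.
by rewrite -HE mulmxA -mulmxDl mulmxBr !mulmxA mulmxN mulNmx addKr addNr mul0mx.
Qed.

Lemma mulmx_conjK (K : pzRingType) m (P Q X : 'M[K]_m) :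
  P *m Q = 1%:M -> P *m (Q *m X *m P) *m Q = X.
Proof. by move=> PQ; rewrite -2!mulmxA PQ mulmx1 mulmxA PQ mul1mx. Qed.

(** Over polynomials, X - PBQ factors as P (X - B) Q, and the determinants of the outer factors
    multiply to 1. *)
Lemma char_poly_conj (K : comNzRingType) m (P Q B : 'M[K]_m) :
  P *m Q = 1%:M -> char_poly (P *m B *m Q) = char_poly B.
Proof.
move=> PQ; rewrite /char_poly.
have PQp : map_mx polyC P *m map_mx polyC Q = 1%:M.
  by rewrite -map_mxM PQ map_mx1.
rewrite (_ : char_poly_mx _ =
    map_mx polyC P *m char_poly_mx B *m map_mx polyC Q).
  by rewrite !det_mulmx mulrAC -det_mulmx PQp det1 mul1r.
rewrite /char_poly_mx mulmxBr mulmxBl -!map_mxM; congr (_ - _).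
by rewrite scalar_mxC -mulmxA PQp mulmx1.
Qed.

Lemma char_polyD_scalar (K : comNzRingType) m (B : 'M[K]_m) (k : K) :
  char_poly (B + k%:M) = char_poly B \Po ('X - k%:P).
Proof.
rewrite /char_poly -det_map_mx /=; congr (\det _).
apply/matrixP => i j; rewrite !mxE rmorphB /= !rmorphMn /=.
rewrite comp_polyX comp_polyC.
by rewrite polyCD polyCMn mulrnBl addrAC opprD addrA.
Qed.

(** Substituting X - k turns each root factor X - b_i into X - (b_i + k), so multiplicities are
    carried along; [P] is injective, which keeps eigenvectors nonzero. *)
Lemma eigensystem_conj_shift (K : fieldType) m (P Q B : 'M[K]_m) (k : K)
    (b : 'I_m -> K) (v : 'I_m -> 'cV[K]_m) :
  P *m Q = 1%:M -> eigensystem B b v ->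
  eigensystem (P *m B *m Q + k%:M) (fun i => b i + k) (fun i => P *m v i).
Proof.
move=> PQ [Bb Bv]; have QP := mulmx1C PQ; split.
  rewrite char_polyD_scalar char_poly_conj// Bb rmorph_prod /=.
  apply: eq_bigr => i _; rewrite comp_polyB comp_polyX comp_polyC.
  by rewrite polyCD opprD addrAC addrA.
move=> i; have [vi0 Bvi] := Bv i; split.
  apply: contra vi0 => /eqP Pv0.
  by rewrite -[v i]mul1mx -QP -mulmxA Pv0 mulmx0.
rewrite mulmxDl -!mulmxA (mulmxA Q) QP mul1mx Bvi mul_scalar_mx.
by rewrite -scalemxAr scalerDl.
Qed.

(** * The matrix exponential and the Lax equation *)

Section mx_derivative.
Context (R : realType).
Local Notation C := (R[i] : numFieldType).

(** The entrywise form lets the scalar product rule and the scalar constancy result apply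
    directly. *)
Definition entry_is_derive m n (M : C -> 'M[C]_(m, n)) (t : C)
    (D : 'M[C]_(m, n)) :=
  forall i j, is_derive t 1 (fun x => M x i j) (D i j).

Lemma entry_is_deriveM m n p (M : C -> 'M[C]_(m, n)) (N : C -> 'M[C]_(n, p))
    t D E :
  entry_is_derive M t D -> entry_is_derive N t E ->
  entry_is_derive (fun x => M x *m N x) t (D *m N t + M t *m E).
Proof.
move=> MD NE i j.
rewrite (_ : (fun x => _) =
    \sum_(k < n) ((fun x => M x i k) * (fun x => N x k j))).
  rewrite (_ : _ i j = \sum_(k < n) (M t i k *: E k j + N t k j *: D i k)).
    by apply: is_derive_sum => k; apply: is_deriveM.
  rewrite !mxE -big_split /=; apply: eq_bigr => k _.
  by rewrite addrC [D i k * _]mulrC.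
by apply/funext => x; rewrite mxE fct_sumE.
Qed.

Lemma entry_is_derive0_cst m n (M : C -> 'M[C]_(m, n)) (s : C) :
  (forall t, entry_is_derive M t 0) -> M s = M 0.
Proof.
move=> M0; apply/matrixP => i j.
apply: (is_derive0_cst (f := fun x => M x i j)) => t.
by have := M0 t i j; rewrite mxE.
Qed.

Lemma norm_mxX_le m (S : 'M[C]_m) : exists2 r : R, 0 <= r &
  forall n i j, `|(S ^+ n) i j| <= r%:C%C ^+ n.
Proof.
(* The sum of all entry norms dominates every column sum, which is what the induction on the power
   multiplies by. *)
pose rC : C := \sum_i \sum_j `|S i j|.
have rC0 : 0 <= rC by do 2![apply: sumr_ge0 => ? _]; rewrite normr_ge0.
have rE : (complex.Re rC)%:C%C = rC by rewrite RRe_real// ger0_real.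
exists (complex.Re rC); first by rewrite -ler0c rE.
rewrite rE; elim=> [|n IH] i j.
  by rewrite expr0 mxE; case: (i == j); rewrite ?normr1 ?normr0.
rewrite exprSr mxE (le_trans (ler_norm_sum _ _ _))//.
apply: (@le_trans _ _ (\sum_k rC ^+ n * `|S k j|)).
  by apply: ler_sum => k _; rewrite normrM ler_wpM2r.
rewrite -mulr_sumr exprSr ler_wpM2l ?exprn_ge0//.
by apply: ler_sum => k _; rewrite (bigD1 j)//= lerDl sumr_ge0.
Qed.

(** [mxexp] is a [limn], so convergence must be shown first; it is obtained entrywise from the
    geometric growth of the powers. *)
Lemma mxexpE m (S : 'M[C]_m) (s : C) i j :
  mxexp (s *: S) i j = egf (fun n => (S ^+ n) i j) s.
Proof.
have [r r0 Sr] := norm_mxX_le S.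
suff : series (fun n : nat => (n`!%:R)^-1 *: (s *: S) ^+ n) @ \oo -->
    \matrix_(i, j) egf (fun n => (S ^+ n) i j) s.
  by move=> /cvg_lim H; rewrite /mxexp H// mxE.
apply: cvg_mx => {}i {}j; rewrite mxE.
have sSn n : (s *: S) ^+ n = s ^+ n *: S ^+ n.
  elim: n => [|n IH]; first by rewrite !expr0 scale1r.
  rewrite !exprS IH -[LHS]/(_ *m _) -[S * _]/(S *m _).
  by rewrite -scalemxAl -scalemxAr scalerA.
have Sr' n : `|(S ^+ n) i j| <= 1%:C%C * r%:C%C ^+ n by rewrite mul1r.
apply: cvg_trans (cvg_egf (s := s) Sr'); apply: near_eq_cvg; near=> n.
rewrite /series /= summxE; apply: eq_bigr => k _.
by rewrite sSn !mxE mulrA.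
Unshelve. all: by end_near. Qed.

(** Serves to recognize the shifted series, whose coefficients are entries of [S ^+ n.+1], as
    entries of a product of [S] with the exponential. *)
Lemma egf_sum (I : finType) (c : I -> C) (a : I -> nat -> C) (s : C) (r : R) :
  (forall i n, `|a i n| <= r%:C%C ^+ n) ->
  egf (fun n => \sum_i c i * a i n) s = \sum_i c i * egf (a i) s.
Proof.
move=> ar; apply: cvg_lim => //.
have ar' i n : `|a i n| <= 1%:C%C * r%:C%C ^+ n by rewrite mul1r.
have H : \sum_i c i * series (egf_term (a i) s) n @[n --> \oo] -->
   \sum_i c i * egf (a i) s.
  apply: cvg_big => [|i _]; first exact: add_continuous.
  exact: cvgM (cvg_cst (c i)) (cvg_egf (ar' i)).
apply: cvg_trans H; apply: near_eq_cvg; near=> n.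
rewrite /series /=; under eq_bigr do rewrite mulr_sumr.
rewrite exchange_big /=; apply: eq_bigr => k _.
by rewrite /egf_term mulr_sumr; apply: eq_bigr => i _; rewrite mulrCA.
Unshelve. all: by end_near. Qed.

(** The two forms come from reading [S ^+ n.+1] as S S^n or as S^n S. Having both lets later product
    rules place [S] on the side where terms cancel. *)
Lemma entry_is_derive_mxexp m (S : 'M[C]_m) (s : C) :
  entry_is_derive (fun x => mxexp (x *: S)) s (S *m mxexp (s *: S)) /\
  entry_is_derive (fun x => mxexp (x *: S)) s (mxexp (s *: S) *m S).
Proof.
have [r r0 Sr] := norm_mxX_le S.
have H i j : is_derive s 1 (fun x => mxexp (x *: S) i j)
    (egf (fun n => (S ^+ n.+1) i j) s).
  rewrite (_ : (fun x => _) = egf (fun n => (S ^+ n) i j)).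
    by apply: (@is_derive_egf R _ s 1 r) => // n; rewrite mul1r.
  by apply/funext => x; exact: mxexpE.
split=> i j.
- rewrite mxE (eq_bigr _ (fun k _ => congr1 _ (mxexpE S s k j))).
  rewrite -(egf_sum _ _ (r := r))//; have := H i j; congr is_derive.
  by congr (egf _ s); apply/funext => n; rewrite exprS mxE.
- rewrite mxE; under eq_bigr do rewrite mulrC mxexpE.
  rewrite -(egf_sum _ _ (r := r))//; have := H i j; congr is_derive.
  congr (egf _ s); apply/funext => n; rewrite exprSr mxE.
  by apply: eq_bigr => k _; rewrite mulrC.
Qed.

Lemma mxexp0 m (S : 'M[C]_m) : mxexp ((0 : C) *: S) = 1%:M.
Proof.
apply/matrixP => i j; rewrite mxexpE; apply: cvg_lim => //.
apply/cvgrPdist_le => e e0; near=> n.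
(* The empty partial sum is 0; every longer one equals its term of index 0, where 0^0 = 1. *)
have n0 : (0 < n)%N by near: n; exact: nbhs_infty_gt.
rewrite -(prednK n0) /series /= big_nat_recl// big1 => [|k _].
  rewrite /egf_term expr0 mulr1 fact0 invr1 mul1r addr0 expr0.
  by rewrite subrr normr0 ltW.
by rewrite /egf_term expr0n mulr0 mul0r.
Unshelve. all: by end_near. Qed.

(** The product has derivative E S F - E S F = 0 and equals 1 at 0, so no Cauchy product of series
    is formed. *)
Lemma mxexpK m (S : 'M[C]_m) (s : C) :
  mxexp (s *: S) *m mxexp (s *: - S) = 1%:M.
Proof.
pose F (x : C) := mxexp (x *: S) *m mxexp (x *: - S).
have <- : F 0 = 1%:M by rewrite /F !mxexp0 mulmx1.
apply: (entry_is_derive0_cst (M := F)) => t.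
have [_ ES] := entry_is_derive_mxexp S t.
have [ENS _] := entry_is_derive_mxexp (- S) t.
have := entry_is_deriveM ES ENS; congr entry_is_derive.
by rewrite mulNmx mulmxN mulmxA subrr.
Qed.

Lemma lax_solution m (S : 'M[C]_m) (k : C) (Bt : C -> 'M[C]_m) :
  entire Bt ->
  (forall t : C, derive1 Bt t + mxcommutator (Bt t) S = k *: 1%:M) ->
  forall t : C,
    Bt t = mxexp (t *: S) *m Bt 0 *m mxexp (t *: - S) + (k * t)%:M.
Proof.
move=> Bentire Bode t.
(* Subtracting the scalar drift leaves the homogeneous equation H' = -[H,S]. *)
pose H (x : C) := Bt x - (k * x)%:M.
have H' x : entry_is_derive H x (derive1 Bt x - k%:M).
  move=> i j; have Bij := derivable_mx_coord i j (Bentire x).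
  have kij : is_derive x 1 (fun y : C => (k * y)%:M i j : C) (k%:M i j).
    (* An entry of the scalar matrix is linear in [y], with slope [k] on the diagonal and 0
       elsewhere. *)
    rewrite (_ : (fun y => _) = (k *+ (i == j)) \*: (id : C -> C)).
      by apply: is_derive_eq; rewrite mxE /GRing.scale /= mulr1.
    by apply/funext => y; rewrite mxE -mulrnAl.
  rewrite (_ : (fun y => H y i j) =
      (fun y => Bt y i j) - (fun y : C => (k * y)%:M i j : C)).
    have := is_deriveB Bij kij; rewrite !mxE; exact.
  by apply/funext => y; rewrite !fctE /H [LHS]mxE [X in _ + X]mxE.
pose G (x : C) := mxexp (x *: - S) *m H x *m mxexp (x *: S).
have G0 : G t = Bt 0.
  rewrite (entry_is_derive0_cst (M := G)) => [|x].
    by rewrite /G /H !mxexp0 mulmx1 mul1mx mulr0 raddf0 subr0.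
  have [ES _] := entry_is_derive_mxexp S x.
  have [_ ENS] := entry_is_derive_mxexp (- S) x.
  have := entry_is_deriveM (entry_is_deriveM ENS (H' x)) ES.
  congr entry_is_derive.
  have -> : derive1 Bt x = k%:M - mxcommutator (Bt x) S.
    by rewrite -scalemx1 -(Bode x) addrK.
  rewrite /H.
  exact: (lax_cancel (mxexp (x *: - S)) (mxexp (x *: S)) (Bt x) S (k * x) k).
by rewrite -G0 /G (mulmx_conjK _ (mxexpK S t)) /H subrK.
Qed.

Lemma eigensystem_lax m (S : 'M[C]_m) (k : C) (Bt : C -> 'M[C]_m)
    (b : 'I_m -> C) (v : 'I_m -> 'cV[C]_m) :
  entire Bt ->
  (forall t : C, derive1 Bt t + mxcommutator (Bt t) S = k *: 1%:M) ->
  eigensystem (Bt 0) b v ->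
  forall t : C, eigensystem (Bt t) (fun i => b i + k * t)
    (fun i => mxexp (t *: S) *m v i).
Proof.
move=> Bentire Bode Bbv t; rewrite (lax_solution Bentire Bode t).
exact: eigensystem_conj_shift (mxexpK S t) Bbv.
Qed.

End mx_derivative.

Theorem lemma1p5 (R : realType) (m : nat) (A B C : 'M[R[i]]_m)
    (a1 a2 : R[i]) (b c : 'I_m -> R[i])
    (u : 'cV[R[i]]_m) (v w : 'I_m -> 'cV[R[i]]_m)
    (k1 k2 : R[i]) (Bt Ct : R[i] -> 'M[R[i]]_m) :
  hypergeometric_triple A B C a1 a2 b c u v w ->
  entire Bt ->
  (forall t : R[i],
     derive1 Bt t + mxcommutator (Bt t) (Smx b v) = k1 *: 1%:M) ->
  Bt 0 = B ->
  entire Ct ->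
  (forall t : R[i],
     derive1 Ct t - mxcommutator (Ct t) (Smx b v) = k2 *: 1%:M) ->
  Ct 0 = C ->
  (forall t1 : R[i],
     eigensystem (Bt t1) (fun i => b i + k1 * t1)
       (fun i => mxexp (t1 *: Smx b v) *m v i)) /\
  (forall t2 : R[i],
     eigensystem (Ct t2) (fun i => - c i + k2 * t2)
       (fun i => mxexp (- (t2 *: Smx b v)) *m w i)).
Proof.
move=> [_ _ _ _ _ _ _ Bbv Ccw _ _ _ _ _ _ _] Bentire Bode B0 Centire Code C0.
split=> t.
  by rewrite -B0 in Bbv; exact: (eigensystem_lax Bentire Bode Bbv).
have Code' (s : (R[i] : numFieldType)) :
    derive1 Ct s + mxcommutator (Ct s) (- Smx b v) = k2 *: 1%:M.
  rewrite -(Code s); congr (_ + _).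
  by rewrite /mxcommutator mulmxN mulNmx opprK opprB addrC.
(* The exponent is rewritten as [t *: - Smx b v], the form produced by the flow of the opposite
   operator. *)
rewrite -scalerN; rewrite -C0 in Ccw.
exact: (eigensystem_lax Centire Code' Ccw).
Qed.
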